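(* Let $H$ be a complex Hilbert space with $\dim H\ge 2$ and let $T\in B(H)$, $T\neq 0$. Then there exists $\varepsilon\in[0,1)$ such that $T$ is $\varepsilon$-AOP if and only if $T$ is bounded from below. Moreover, $$m(T)=\sqrt{\frac{1-\hat{\varepsilon}(T)}{1+\hat{\varepsilon}(T)}}\;\|T\|.$$
   Context: $B(H)$ is the set of bounded linear operators on $H$. For $\varepsilon\in[0,1]$, an operator $T\in B(H)$ is called $\varepsilon$-AOP (approximately orthogonality-preserving) if for all $x,y\in H$ with $\langle x,y\rangle=0$ one has $|\langle Tx,Ty\rangle|\le\varepsilon\|Tx\|\,\|Ty\|$ (so every operator is $1$-AOP). Define $\hat{\varepsilon}(T)=\inf\{\varepsilon\in[0,1]: T\text{ is }\varepsilon\text{-AOP}\}$. The minimum modulus is $m(T)=\inf\{\|Tx\|: x\in H,\ \|x\|=1\}$; $T$ is bounded from below if $m(T)>0$. *)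

(* Defs.v *)
From mathcomp Require Import all_boot all_order all_algebra.
From mathcomp Require Import complex.
From mathcomp Require Import all_classical all_reals all_analysis.

Set Implicit Arguments.
Unset Strict Implicit.
Unset Printing Implicit Defensive.

Import Order.TTheory GRing.Theory Num.Theory.
Import numFieldNormedType.Exports.

Local Open Scope classical_set_scope.
Local Open Scope ring_scope.
Local Open Scope complex_scope.

(* A complex Hilbert space is a complete normed module H over R[i] together
   with a positive definite hermitian form ip : {dot H for Num.conj} (linear in
   its first argument) that induces the norm of H. *)
Definition induces_norm (R : realType) (H : completeNormedModType R[i])
    (ip : {dot H for @Num.conj R[i]}) : Prop :=
  forall x : H, `|x| ^+ 2 = ip x x.

(* The norm of a normed module over R[i] takes its values in R[i], on the
   nonnegative real axis; rnorm is the same norm with values in R. *)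
Definition rnorm (R : realType) (H : normedModType R[i]) (x : H) : R :=
  complex.Re `|x|.

Definition lin_indep (K : nzRingType) (V : lmodType K) (n : nat)
    (v : 'I_n -> V) : Prop :=
  forall a : 'I_n -> K, \sum_(i < n) a i *: v i = 0 -> forall i, a i = 0.

(* Makes sense for infinite-dimensional V, where \dim is not available. *)
Definition dim_at_least (K : nzRingType) (V : lmodType K) (n : nat) : Prop :=
  exists v : 'I_n -> V, lin_indep v.

Definition bounded_operator (R : realType) (H : normedModType R[i])
    (T : {linear H -> H}) : Prop :=
  exists M : R, forall x : H, rnorm (T x) <= M * rnorm x.

Definition op_norm (R : realType) (H : normedModType R[i])
    (T : {linear H -> H}) : R :=
  sup [set rnorm (T x) | x in [set x : H | rnorm x <= 1]].

Definition min_modulus (R : realType) (H : normedModType R[i])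
    (T : {linear H -> H}) : R :=
  inf [set rnorm (T x) | x in [set x : H | rnorm x = 1]].

Definition bounded_from_below (R : realType) (H : normedModType R[i])
    (T : {linear H -> H}) : Prop :=
  0 < min_modulus T.

Definition is_AOP (R : realType) (H : completeNormedModType R[i])
    (ip : {dot H for @Num.conj R[i]}) (eps : R) (T : {linear H -> H}) : Prop :=
  forall x y : H, ip x y = 0 ->
    `|ip (T x) (T y)| <= (eps * rnorm (T x) * rnorm (T y))%:C.

Definition eps_hat (R : realType) (H : completeNormedModType R[i])
    (ip : {dot H for @Num.conj R[i]}) (T : {linear H -> H}) : R :=
  inf [set eps : R | 0 <= eps <= 1 /\ is_AOP ip eps T].

(* Main.v *)
(** With M = ||T|| and m = m(T), both claims follow from
    eps_hat(T) = (M^2 - m^2) / (M^2 + m^2).  That T is AOP with this constant is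
    Wielandt's inequality.  Conversely, if T is eps-AOP and u, v are unit
    vectors, rotated so that <u, v> is real, then u + v and u - v are orthogonal
    and |Tu|^2 - |Tv|^2 = Re <T(u+v), T(u-v)> <= eps |T(u+v)| |T(u-v)|
    <= eps (|Tu|^2 + |Tv|^2); optimizing over u and v gives
    (1 - eps) M^2 <= (1 + eps) m^2. *)

Require Import Defs.
From mathcomp Require Import all_boot all_order all_algebra.
From mathcomp Require Import complex ring lra.
From mathcomp Require Import all_classical all_reals all_analysis.

Set Implicit Arguments.
Unset Strict Implicit.
Unset Printing Implicit Defensive.

Import Order.TTheory GRing.Theory Num.Theory.
Import numFieldNormedType.Exports.

Local Open Scope classical_set_scope.
Local Open Scope ring_scope.
Local Open Scope complex_scope.

(** * The real-valued norm and expansions of its square *)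

Lemma rnormE (R : realType) (H : normedModType R[i]) (x : H) :
  (rnorm x)%:C = `|x|.
Proof. by rewrite RRe_real // normr_real. Qed.

Lemma rnorm_ge0 (R : realType) (H : normedModType R[i]) (x : H) :
  0 <= rnorm x.
Proof. by rewrite -ler0c rnormE. Qed.

Lemma rnorm_eq0 (R : realType) (H : normedModType R[i]) (x : H) :
  rnorm x = 0 -> x = 0.
Proof. by move=> x0; apply/eqP; rewrite -normr_eq0 -rnormE x0. Qed.

Lemma rnorm_gt0 (R : realType) (H : normedModType R[i]) (x : H) :
  x != 0 -> 0 < rnorm x.
Proof.
move=> x0; rewrite lt_neqAle rnorm_ge0 andbT eq_sym.
by apply: contra x0 => /eqP /rnorm_eq0 ->.
Qed.

Lemma rnorm0 (R : realType) (H : normedModType R[i]) : rnorm (0 : H) = 0.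
Proof. by rewrite /rnorm normr0. Qed.

Lemma rnormN (R : realType) (H : normedModType R[i]) (x : H) :
  rnorm (- x) = rnorm x.
Proof. by rewrite /rnorm normrN. Qed.

Lemma rnormZ_unit (R : realType) (H : normedModType R[i]) (c : R[i]) (x : H) :
  `|c| = 1 -> rnorm (c *: x) = rnorm x.
Proof. by move=> c1; rewrite /rnorm normrZ c1 mul1r. Qed.

Lemma rnormZ_ge0 (R : realType) (H : normedModType R[i]) (t : R) (x : H) :
  0 <= t -> rnorm (t%:C *: x) = t * rnorm x.
Proof.
move=> t0; have t0c : 0 <= t%:C :> R[i] by rewrite ler0c.
rewrite /rnorm normrZ (ger0_norm t0c).
by rewrite -(rnormE x) -rmorphM.
Qed.

Lemma rnorm_normalized (R : realType) (H : normedModType R[i]) (x : H) :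
  x != 0 -> rnorm ((rnorm x)^-1%:C *: x) = 1.
Proof.
move=> x0; rewrite rnormZ_ge0 ?invr_ge0 ?rnorm_ge0 // mulVf //.
by rewrite gt_eqF // rnorm_gt0.
Qed.

(** Rotating a vector by such a [c] makes an inner product real and nonnegative while leaving all
    norms unchanged. *)
Lemma unit_phase (R : realType) (z : R[i]) :
  exists2 c : R[i], `|c| = 1 & c * z = `|z|.
Proof.
have [->|z0] := eqVneq z 0; first by exists 1; rewrite ?normr1 ?mulr0 ?normr0.
exists (`|z| / z); last by rewrite divfK.
by rewrite normf_div normr_id divff // normr_eq0.
Qed.

Lemma rnorm_sqrD (R : realType) (H : completeNormedModType R[i])
    (ip : {dot H for @Num.conj R[i]}) (x y : H) :
  induces_norm ip ->
  rnorm (x + y) ^+ 2 = rnorm x ^+ 2 + rnorm y ^+ 2 + 2 * complex.Re (ip x y).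
Proof.
move=> ipN.
have rnorm_sqr z : rnorm z ^+ 2 = complex.Re (ip z z).
  by rewrite -ipN -rnormE -rmorphXn.
rewrite !rnorm_sqr dnormD /=.
by case: (ip x x) (ip y y) (ip x y) => [a b] [c d] [e f] /=; ring.
Qed.

(** Meant for the test vectors of Wielandt's inequality. A minus sign is carried by the vector [y],
    so nonnegative real coefficients suffice. *)
Lemma rnorm_sqr_comb (R : realType) (H : completeNormedModType R[i])
    (ip : {dot H for @Num.conj R[i]}) (s t : R) (x y : H) :
  induces_norm ip -> 0 <= s -> 0 <= t ->
  rnorm (s%:C *: x + t%:C *: y) ^+ 2 =
    s ^+ 2 * rnorm x ^+ 2 + t ^+ 2 * rnorm y ^+ 2
    + 2 * s * t * complex.Re (ip x y).
Proof.
move=> ipN s0 t0; rewrite (rnorm_sqrD _ _ ipN) !rnormZ_ge0 //.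
rewrite linearZl_LR linearZr_LR /=.
by case: (ip x y) => [e f]; simpc => /=; ring.
Qed.

(** * Operator norm and minimum modulus *)

Lemma op_norm_ub (R : realType) (H : normedModType R[i]) (T : {linear H -> H})
    (x : H) :
  bounded_operator T -> rnorm (T x) <= op_norm T * rnorm x.
Proof.
move=> [M TM]; have [->|x0] := eqVneq x 0.
  by rewrite raddf0 !rnorm0 mulr0.
have nx_gt0 := rnorm_gt0 x0.
suff : rnorm (T ((rnorm x)^-1%:C *: x)) <= op_norm T.
  by rewrite linearZ /= rnormZ_ge0 ?invr_ge0 ?rnorm_ge0 // mulrC ler_pdivrMr.
apply: sup_upper_bound; last first.
  by exists ((rnorm x)^-1%:C *: x) => //=; rewrite rnorm_normalized.
split; first by exists (rnorm (T 0)); exists 0 => //=; rewrite rnorm0.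
(* Boundedness does not state the sign of [M], hence the absolute value. *)
exists `|M| => _ [z /= z1 <-]; apply: le_trans (TM z) _.
apply: (@le_trans _ _ (`|M| * rnorm z)).
  by apply: ler_wpM2r (ler_norm _); exact: rnorm_ge0.
by rewrite ler_piMr.
Qed.

(** The supremum in [op_norm] runs over the closed unit ball. Normalizing reduces it to the sphere,
    except at the zero vector, where [0 <= k] is used. *)
Lemma op_norm_le (R : realType) (H : normedModType R[i]) (T : {linear H -> H})
    (k : R) :
  0 <= k -> (forall x, rnorm x = 1 -> rnorm (T x) <= k) -> op_norm T <= k.
Proof.
move=> k0 Tk; apply: ge_sup.
  by exists (rnorm (T 0)); exists 0 => //=; rewrite rnorm0.
move=> _ [x /= x1 <-]; have [->|x0] := eqVneq x 0.
  by rewrite raddf0 rnorm0.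
have nx_gt0 := rnorm_gt0 x0.
have := Tk _ (rnorm_normalized x0).
rewrite linearZ /= rnormZ_ge0 ?invr_ge0 ?rnorm_ge0 // mulrC ler_pdivrMr // => h.
by apply: le_trans h _; rewrite ler_piMr.
Qed.

Lemma min_modulus_lb (R : realType) (H : normedModType R[i])
    (T : {linear H -> H}) (x : H) :
  min_modulus T * rnorm x <= rnorm (T x).
Proof.
have [->|x0] := eqVneq x 0; first by rewrite raddf0 !rnorm0 mulr0.
have nx_gt0 := rnorm_gt0 x0.
suff : min_modulus T <= rnorm (T ((rnorm x)^-1%:C *: x)).
  rewrite linearZ /= rnormZ_ge0 ?invr_ge0 ?rnorm_ge0 //.
  by rewrite [X in _ <= X]mulrC ler_pdivlMr.
apply: ge_inf; first by exists 0 => _ [z _ <-]; exact: rnorm_ge0.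
by exists ((rnorm x)^-1%:C *: x) => //=; rewrite rnorm_normalized.
Qed.

(** A nonzero vector makes the unit sphere nonempty; the infimum of the empty set would be [0] by
    convention. *)
Lemma le_min_modulus (R : realType) (H : normedModType R[i])
    (T : {linear H -> H}) (k : R) :
  (exists x : H, x != 0) ->
  (forall x, rnorm x = 1 -> k <= rnorm (T x)) -> k <= min_modulus T.
Proof.
move=> [x x0] kT; apply: lb_le_inf.
  exists (rnorm (T ((rnorm x)^-1%:C *: x))).
  by exists ((rnorm x)^-1%:C *: x) => //=; rewrite rnorm_normalized.
by move=> _ [z /= z1 <-]; exact: kT.
Qed.

(** * Approximate orthogonality versus two-sided norm bounds *)

Lemma is_AOP_sphere (R : realType) (H : completeNormedModType R[i])
    (ip : {dot H for @Num.conj R[i]}) (T : {linear H -> H}) (eps : R) (u v : H) :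
  induces_norm ip -> 0 <= eps -> is_AOP ip eps T -> rnorm u = rnorm v ->
  (1 - eps) * rnorm (T u) ^+ 2 <= (1 + eps) * rnorm (T v) ^+ 2.
Proof.
move=> ipN eps0 epsT uv.
have [c c1 cuv] := unit_phase (ip u v).
rewrite -(rnormZ_unit u c1) in uv.
rewrite -(rnormZ_unit (T u) c1) -linearZ /=.
have {}cuv : ip (c *: u) v = `|ip u v| by rewrite linearZl_LR.
move: (c *: u) uv cuv => w wv ipwv.
have ip_sqr z : ip z z = (rnorm z ^+ 2)%:C.
  by rewrite -ipN -rnormE rmorphXn.
have vw : ip v w = ip w v.
  by rewrite hermC expr0 mul1r /= ipwv conj_Creal ?normr_real.
have ipDB x y : ip (x + y) (x - y) = ip x x - ip y y + (ip y x - ip x y).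
  by rewrite linearDl !linearBr; ring.
have orth : ip (w + v) (w - v) = 0.
  by rewrite ipDB vw !ip_sqr wv !subrr addr0.
have := epsT _ _ orth; rewrite raddfD raddfB ipDB.
set z := (X in `|X|) => hz.
(* The cross terms of [z] are a number minus its conjugate, hence purely imaginary. *)
have Rez : complex.Re z = rnorm (T w) ^+ 2 - rnorm (T v) ^+ 2.
  rewrite /z [ip (T v) (T w)]hermC expr0 mul1r !ip_sqr /=.
  by case: (ip (T w) (T v)) => [e f] /=; ring.
have : complex.Re z <= eps * rnorm (T w + T v) * rnorm (T w - T v).
  rewrite -lecR; apply: le_trans hz; apply: le_trans (normc_ge_Re z).
  by rewrite lecR ler_norm.
have N1 := rnorm_sqrD (T w) (T v) ipN.
have := rnorm_sqrD (T w) (- T v) ipN.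
rewrite rnormN linearNr raddfN /=.
move: N1; rewrite Rez.
set a := rnorm (T w); set b := rnorm (T v).
set p := rnorm (T w + T v); set q := rnorm (T w - T v) => N1 N2 h.
(* AM-GM for [p q]; combined with the parallelogram law on the next line it gives
   [eps p q <= eps (a^2 + b^2)]. *)
have : 0 <= eps * (p - q) ^+ 2 by rewrite mulr_ge0 ?sqr_ge0.
have : eps * p ^+ 2 + eps * q ^+ 2 = 2 * eps * (a ^+ 2 + b ^+ 2).
  by rewrite N1 N2; ring.
nra.
Qed.

(* Wielandt's inequality: writing [a = |T x|], [b = |T y|], test the two-sided
   bound of [|T z| / |z|] on [z = b x + a y] and [z = b x - a y]. *)
Lemma two_sided_bound_is_AOP (R : realType) (H : completeNormedModType R[i])
    (ip : {dot H for @Num.conj R[i]}) (T : {linear H -> H}) (m M : R) :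
  induces_norm ip -> 0 <= m -> 0 < M ->
  (forall x, m * rnorm x <= rnorm (T x)) ->
  (forall x, rnorm (T x) <= M * rnorm x) ->
  is_AOP ip ((M ^+ 2 - m ^+ 2) / (M ^+ 2 + m ^+ 2)) T.
Proof.
move=> ipN m0 M0 mT TM x y xy.
(* After a rotation of [x], the inner product of [T x] and [T y] equals its own modulus, so only an
   inequality between reals remains. *)
have [c c1 cxy] := unit_phase (ip (T x) (T y)).
rewrite -(rnormZ_unit (T x) c1) -cxy -linearZl_LR -[c *: T x]linearZ /=.
have : ip (c *: x) y = 0 by rewrite linearZl_LR /= xy mulr0.
have : ip (T (c *: x)) (T y) = (complex.Re (ip (T (c *: x)) (T y)))%:C.
  by rewrite linearZ linearZl_LR /= cxy RRe_real // normr_real.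
move: (c *: x) => {xy cxy c1 c}x -> xy; rewrite lecR.
have mT2 z : m ^+ 2 * rnorm z ^+ 2 <= rnorm (T z) ^+ 2.
  by rewrite -exprMn lerXn2r ?nnegrE ?mulr_ge0 ?rnorm_ge0.
have TM2 z : rnorm (T z) ^+ 2 <= M ^+ 2 * rnorm z ^+ 2.
  by rewrite -exprMn lerXn2r ?nnegrE ?mulr_ge0 ?rnorm_ge0 // ltW.
have M2_gt0 : 0 < M ^+ 2 by rewrite exprn_gt0.
have m2_ge0 := sqr_ge0 m.
set a := rnorm (T x); set b := rnorm (T y); set r := complex.Re _.
have a0 : 0 <= a := rnorm_ge0 _; have b0 : 0 <= b := rnorm_ge0 _.
have [Tx0|Tx_neq0] := eqVneq (T x) 0.
  by rewrite /r /a Tx0 linear0l rnorm0 /= mulr0 mul0r.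
have [Ty0|Ty_neq0] := eqVneq (T y) 0.
  by rewrite /r /b Ty0 linear0r rnorm0 /= mulr0.
have a_gt0 : 0 < a := rnorm_gt0 Tx_neq0.
have b_gt0 : 0 < b := rnorm_gt0 Ty_neq0.
(* Since [x] and [y] are orthogonal, [N] is the squared norm of both [b x + a y] and [b x - a y],
   whereas their images have squared norms [2ab(ab + r)] and [2ab(ab - r)]. *)
set N := b ^+ 2 * rnorm x ^+ 2 + a ^+ 2 * rnorm y ^+ 2.
have up : 2 * a * b * (a * b + r) <= M ^+ 2 * N.
  have := TM2 (b%:C *: x + a%:C *: y).
  rewrite linearD !linearZ /= !(rnorm_sqr_comb _ _ ipN) // xy /= -/a -/b -/r.
  by rewrite /N; nra.
have lo : m ^+ 2 * N <= 2 * a * b * (a * b - r).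
  have := mT2 (b%:C *: x + a%:C *: (- y)).
  rewrite linearD !linearZ !(rnorm_sqr_comb _ _ ipN) // (raddfN T).
  rewrite !rnormN !linearNr /= xy oppr0 /= raddfN /= -/a -/b -/r.
  by rewrite /N; nra.
(* Scaling [up] by [m^2] and [lo] by [M^2] produces the common term [m^2 M^2 N], which is
   eliminated; then [2ab] cancels. *)
have {up lo} h : m ^+ 2 * (a * b + r) <= M ^+ 2 * (a * b - r).
  have ab0 : 0 < 2 * a * b by rewrite !mulr_gt0.
  rewrite -(ler_pM2l ab0).
  move: (ler_wpM2l m2_ge0 up) (ler_wpM2l (ltW M2_gt0) lo); lra.
have D0 : 0 < M ^+ 2 + m ^+ 2 by rewrite ltr_wpDr.
by rewrite -mulrA mulrAC ler_pdivlMr //; lra.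
Qed.

(** This is the optimization over unit vectors. Taking square roots in [is_AOP_sphere] first makes
    the estimate linear in the norms, so that the supremum over [u] and the infimum over [v] can be
    taken directly. *)
Lemma is_AOP_norm_bound (R : realType) (H : completeNormedModType R[i])
    (ip : {dot H for @Num.conj R[i]}) (T : {linear H -> H}) (eps : R) :
  induces_norm ip -> (exists x : H, x != 0) -> bounded_operator T ->
  0 <= eps <= 1 ->
  is_AOP ip eps T ->
  (1 - eps) * op_norm T ^+ 2 <= (1 + eps) * min_modulus T ^+ 2.
Proof.
move=> ipN H0 bT /andP[eps0 eps1] epsT.
set M := op_norm T; set m := min_modulus T.
have M0 : 0 <= M.
  have [x /rnorm_gt0 x0] := H0; rewrite -(pmulr_lge0 _ x0).
  by apply: le_trans (op_norm_ub x bT); exact: rnorm_ge0.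
have m0 : 0 <= m by apply: le_min_modulus => // x _; exact: rnorm_ge0.
set r := (1 - eps) / (1 + eps).
have D0 : 0 < 1 + eps by rewrite ltr_wpDr.
have r0 : 0 <= r by rewrite divr_ge0 ?subr_ge0 // ltW.
have rM0 : 0 <= Num.sqrt r * M by rewrite mulr_ge0 // sqrtr_ge0.
have sphere u v : rnorm u = 1 -> rnorm v = 1 ->
    Num.sqrt r * rnorm (T u) <= rnorm (T v).
  move=> u1 v1.
  rewrite -ler_sqr ?nnegrE ?mulr_ge0 ?sqrtr_ge0 ?rnorm_ge0 //.
  rewrite exprMn sqr_sqrtr // /r mulrAC ler_pdivrMr // [X in _ <= X]mulrC.
  by apply: (is_AOP_sphere ipN) => //; rewrite u1 v1.
suff : Num.sqrt r * M <= m.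
  rewrite -ler_sqr ?nnegrE // exprMn sqr_sqrtr // /r mulrAC.
  by rewrite ler_pdivrMr // [X in _ <= X]mulrC.
(* The root vanishes when [eps = 1]; the claim is then [0 <= m]. Otherwise one may divide by it. *)
have [->|s_neq0] := eqVneq (Num.sqrt r) 0; first by rewrite mul0r.
have s0 : 0 < Num.sqrt r by rewrite lt_neqAle eq_sym s_neq0 sqrtr_ge0.
rewrite mulrC -ler_pdivlMr //; apply: op_norm_le => [|u u1].
  by rewrite divr_ge0 // ltW.
rewrite ler_pdivlMr // mulrC; apply: le_min_modulus => // v v1.
exact: sphere.
Qed.

(** The map sending [t] to [(1 - t) / (1 + t)] is an involution, and [e] is its value at
    [(m / M)^2]. *)
Lemma wielandt_ratio (F : realFieldType) (m M : F) :
  M != 0 ->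
  let e := (M ^+ 2 - m ^+ 2) / (M ^+ 2 + m ^+ 2) in
  (1 - e) / (1 + e) = (m / M) ^+ 2.
Proof.
move=> M0 /=; have M2 : 0 < M ^+ 2 by rewrite exprn_even_gt0.
have D0 : 0 < M ^+ 2 + m ^+ 2 by rewrite ltr_wpDr ?sqr_ge0.
by field; rewrite M0 !gt_eqF //= addrCA addrK addr_gt0.
Qed.

Theorem corollary2p5 (R : realType) (H : completeNormedModType R[i])
    (ip : {dot H for @Num.conj R[i]}) (T : {linear H -> H}) :
  induces_norm ip ->
  dim_at_least H 2 ->
  bounded_operator T ->
  T <> \0 :> (H -> H) ->
  ((exists eps : R, 0 <= eps < 1 /\ is_AOP ip eps T) <-> bounded_from_below T)
  /\ min_modulus T =
       Num.sqrt ((1 - eps_hat ip T) / (1 + eps_hat ip T)) * op_norm T.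
Proof.
move=> ipN _ bT T_neq0.
have [x Tx0] : exists x, T x != 0.
  apply: contrapT => noT; apply: T_neq0; apply/funext => x.
  by apply/eqP/negPn/negP => Tx0; apply: noT; exists x.
have x0 : x != 0 by apply: contra Tx0 => /eqP ->; rewrite raddf0.
have H0 : exists x : H, x != 0 by exists x.
set M := op_norm T; set m := min_modulus T.
have M0 : 0 < M.
  rewrite -(pmulr_lgt0 _ (rnorm_gt0 x0)).
  by apply: lt_le_trans (op_norm_ub x bT); exact: rnorm_gt0.
have m0 : 0 <= m by apply: le_min_modulus => // y _; exact: rnorm_ge0.
have mM : m <= M.
  rewrite -(ler_pM2r (rnorm_gt0 x0)).
  by apply: le_trans (op_norm_ub x bT); exact: min_modulus_lb.
have M2 : 0 < M ^+ 2 by rewrite exprn_gt0.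
have m2 : 0 <= m ^+ 2 by rewrite sqr_ge0.
have m2M2 : m ^+ 2 <= M ^+ 2 by rewrite lerXn2r ?nnegrE // ltW.
have D0 : 0 < M ^+ 2 + m ^+ 2 by rewrite ltr_wpDr.
set e := (M ^+ 2 - m ^+ 2) / (M ^+ 2 + m ^+ 2).
have e0 : 0 <= e by rewrite divr_ge0 ?subr_ge0 // ltW.
have e1 : e <= 1 by rewrite ler_pdivrMr // mul1r; lra.
have eT : is_AOP ip e T.
  apply: (two_sided_bound_is_AOP ipN) => // y; first exact: min_modulus_lb.
  exact: op_norm_ub.
(* Solving [(1 - eps) M^2 <= (1 + eps) m^2] for [eps] gives exactly [e <= eps]. With [eT], the
   infimum [eps_hat] is therefore attained at [e]. *)
have e_min eps : 0 <= eps <= 1 -> is_AOP ip eps T -> e <= eps.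
  move=> eps01 epsT; have := is_AOP_norm_bound ipN H0 bT eps01 epsT.
  rewrite -/M -/m /e ler_pdivrMr //; lra.
have -> : eps_hat ip T = e.
  apply/eqP; rewrite eq_le; apply/andP; split.
    by apply: ge_inf; [exists 0 => z [/andP[z0 _] _] | split=> //; rewrite e0 e1].
  by apply: lb_le_inf; [exists e; split=> //; rewrite e0 e1 | move=> z [] /e_min].
split; last first.
  rewrite wielandt_ratio ?gt_eqF //.
  by rewrite sqrtr_sqr ger0_norm ?divr_ge0 ?(ltW M0) // divfK // gt_eqF.
rewrite /bounded_from_below -/m; split=> [[eps [/andP[eps0 eps1] epsT]]|m_gt0].
  have eps01 : 0 <= eps <= 1 by rewrite eps0 ltW.
  have := is_AOP_norm_bound ipN H0 bT eps01 epsT; rewrite -/M -/m.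
  (* If [m = 0], the bound reads [(1 - eps) M^2 <= 0], which is impossible for [eps < 1]. *)
  rewrite lt_neqAle m0 andbT eq_sym; apply: contraTneq => ->.
  by rewrite expr0n mulr0 -ltNge mulr_gt0 // subr_gt0.
(* The optimal constant is the witness: [e < 1] amounts to [0 < m^2]. *)
exists e; rewrite e0; split=> //; rewrite /e ltr_pdivrMr // mul1r.
by have : 0 < m ^+ 2; [rewrite exprn_gt0 | lra].
Qed.
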